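(* There exists an $E$-system $(X,f)$ which has the $\mathscr{M}_{0}$-shadowing property and is not weakly mixing.
   Context: $\mathbb{N}=\{1,2,3,\ldots\}$ and $\mathbb{N}_0=\{0,1,2,\ldots\}$. A dynamical system is a pair $(X,f)$ where $(X,d)$ is a compact metric space and $f\colon X\to X$ is a continuous surjection. Transitivity notions: for $A,B\subseteq X$, $N_f(A,B)=\{n\in\mathbb{N}: f^n(A)\cap B\neq\varnothing\}$. $(X,f)$ is transitive if $N_f(U,V)\neq\varnothing$ for all nonempty open $U,V\subseteq X$; it is weakly mixing if $(X\times X,f\times f)$ is transitive. $\mathcal{M}(X,f)$ is the set of $f$-invariant Borel probability measures on $X$; $\operatorname{supp}(\mu)$ is the set of $x\in X$ with $\mu(U)>0$ for every open neighborhood $U$ of $x$; $\mu$ has full support if $\operatorname{supp}(\mu)=X$. $(X,f)$ is an $E$-system if it is transitive and some $\mu\in\mathcal{M}(X,f)$ has full support. Density and shadowing: for $A\subseteq\mathbb{N}_0$, $\underline{\mathrm{Dens}}(A)=\liminf_{n\to\infty}\frac{\#(A\cap\{0,\ldots,n\})}{n+1}$. For $\delta>0$, a sequence $\{x_i\}_{i=0}^\infty\subseteq X$ is a $\delta$-ergodic pseudo-orbit if $\lim_{n\to\infty}\frac{1}{n}\#\{0\le i<n: d(f(x_i),x_{i+1})\ge\delta\}=0$. $(X,f)$ has the $\mathscr{M}_0$-shadowing property if for every $\varepsilon>0$ there is $\delta>0$ such that for every $\delta$-ergodic pseudo-orbit $\{x_i\}_{i=0}^\infty$ there is $z\in X$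 with $\underline{\mathrm{Dens}}(\{j\in\mathbb{N}_0: d(f^j(z),x_j)<\varepsilon\})>0$. *)

(* Defs.v *)
From HB Require Import structures.
From mathcomp Require Import all_boot all_order all_algebra.
From mathcomp Require Import all_classical all_reals all_analysis.

Set Implicit Arguments.
Unset Strict Implicit.
Unset Printing Implicit Defensive.

Import Order.TTheory GRing.Theory Num.Theory.
Import numFieldNormedType.Exports.

Local Open Scope classical_set_scope.
Local Open Scope ring_scope.

(* The library's measurable types are pointed, whereas [metricType] is not.
   Pointedness only excludes the empty space, which carries no probability
   measure. *)
#[short(type="pointedMetricType")]
HB.structure Definition PointedMetric (K : numDomainType) :=
  {T of Metric K T & Pointed T}.

Section Transitivity.
Context {T : topologicalType}.
Implicit Types (f : T -> T) (A B : set T).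

Definition hitting_times f A B : set nat :=
  [set n | (0 < n)%N /\ (iter n f @` A) `&` B !=set0].

Definition topologically_transitive f : Prop :=
  forall U V : set T, open U -> open V -> U !=set0 -> V !=set0 ->
    hitting_times f U V !=set0.

End Transitivity.

Definition weakly_mixing {T : topologicalType} (f : T -> T) : Prop :=
  topologically_transitive (fun p : T * T => (f p.1, f p.2)).

Notation borel_space X := (g_sigma_algebraType (@open X)).

Section DynamicalSystem.
Context {R : realType} {X : pointedMetricType R}.
Implicit Type f : X -> X.

Definition dynamical_system f : Prop :=
  [/\ compact [set: X], continuous f & range f = [set: X]].

Definition invariant_measure f (mu : probability (borel_space X) R) : Prop :=
  forall A : set (borel_space X), measurable A -> mu (f @^-1` A) = mu A.

Definition measure_support (mu : probability (borel_space X) R) : set X :=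
  [set x | forall U : set X, open U -> U x -> (0 < mu U)%E].

Definition E_system f : Prop :=
  [/\ dynamical_system f, topologically_transitive f &
      exists mu : probability (borel_space X) R,
        invariant_measure f mu /\ measure_support mu = [set: X]].

End DynamicalSystem.

(* #(A `&` {0, ..., n - 1}) *)
Definition count_below (A : set nat) (n : nat) : nat :=
  #|[pred i : 'I_n | (i : nat) \in A]|.

Definition lower_density (R : realType) (A : set nat) : R :=
  limn_inf (fun n : nat => (count_below A n.+1)%:R / n.+1%:R : R).

Section Shadowing.
Context {R : realType} {X : pointedMetricType R}.
Implicit Types (f : X -> X) (x : nat -> X).

Definition ergodic_pseudo_orbit f (delta : R) x : Prop :=
  (fun n : nat =>
     n%:R^-1 * (count_below [set i | delta <= mdist (f (x i)) (x i.+1)] n)%:R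
       : R) @ \oo --> (0 : R).

Definition M0_shadowing f : Prop :=
  forall eps : R, 0 < eps -> exists2 delta : R, 0 < delta &
    forall x, ergodic_pseudo_orbit f delta x ->
      exists z : X,
        0 < lower_density R [set j | mdist (iter j f z) (x j) < eps].

End Shadowing.

(* Main.v *)
Require Import Defs.
From HB Require Import structures.
From mathcomp Require Import all_boot all_order all_algebra finmap.
From mathcomp Require Import all_classical all_reals all_analysis.
From mathcomp Require Import zify lra.

(** Let w be the limit of the blocks B_0 = 10 and B_(k+1) = B_k B_k 0^(2k), and
    let X be the closure of its orbit under the shift.

    All 1s of w sit at even positions, so in a point of X all 1s have the same
    parity.  Hence a return to the open set of points starting with 1 takes an
    even time, a passage from it to the points having a 1 at position 1 takes
    an odd time, and the shift cannot be weakly mixing ([hull_parity]).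

    The spacers 0^(2k) grow, so every point of X meets arbitrarily long runs of
    zeros with bounded gaps ([limit_word_zeros]): the fixed point 0^oo is
    approached syndetically from everywhere.  Such a fixed point by itself
    traces every ergodic pseudo-orbit on a set of positive lower density,
    since away from a set of zero density a pseudo-orbit with small errors
    follows true orbits long enough to visit the fixed point
    ([M0_shadowing_of_syndetic_fixpoint]).

    The spacers are nevertheless so short that the block lengths stay below
    4 2^k, so that B_K occurs in w with positive frequency
    ([count_limit_word]).  A limit of empirical measures along the prefixes
    B_j is then an invariant measure of full support
    ([Krylov_Bogoliubov], [hull_full_support]).  Since X is zero-dimensional,
    this limit can be taken along an ultrafilter, separately on each clopen
    set; compactness makes the resulting content sigma-additive
    ([clopen_extension]).  Recurrence of w gives transitivity. *)

Set Implicit Arguments.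
Unset Strict Implicit.
Unset Printing Implicit Defensive.

Import Order.TTheory GRing.Theory Num.Theory.
Import numFieldNormedType.Exports.

Local Open Scope classical_set_scope.
Local Open Scope nat_scope.

(** * Counting integers in an initial segment *)

Lemma count_belowS A n : count_below A n.+1 = count_below A n + (n \in A).
Proof.
rewrite /count_below -!sum1_card [LHS]big_mkcond big_ord_recr /=.
by congr (_ + _); rewrite [RHS]big_mkcond.
Qed.

Lemma count_below0 A : count_below A 0 = 0.
Proof. by rewrite /count_below; apply: eq_card0 => -[]. Qed.

Lemma count_belowD A m n :
  count_below A (m + n) = count_below A m + count_below [set i | A (m + i)] n.
Proof.
elim: n => [|n IH]; first by rewrite count_below0 !addn0.
by rewrite addnS !count_belowS IH addnA.
Qed.

Lemma count_below_subset A B n : A `<=` B -> count_below A n <= count_below B n.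
Proof.
move=> AB; elim: n => [|n IH]; first by rewrite count_below0.
rewrite !count_belowS leq_add//; case: (boolP (n \in A)) => //= /set_mem/AB nB.
by rewrite mem_set.
Qed.

Lemma count_below_setU (A B : set nat) n :
  (count_below (A `|` B) n <= count_below A n + count_below B n).
Proof.
elim: n => [|n IH]; first by rewrite !count_below0.
rewrite !count_belowS in_setU; move: IH.
by case: (n \in A); case: (n \in B) => /=; lia.
Qed.

Lemma count_below_gt0 (A : set nat) i n : (i < n) -> A i -> (0 < count_below A n).
Proof.
move=> ni Ai; rewrite -(subnKC ni) count_belowD count_belowS mem_set//; lia.
Qed.

(** Each of the [m %/ N.+1] disjoint windows of length [N.+1] below [m] meets
    the set. *)
Lemma count_below_syndetic (A : set nat) N m :
  (forall i, exists2 n, (n <= N) & A (i + n)) ->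
  (m %/ N.+1 <= count_below A m).
Proof.
move=> synA; rewrite [X in count_below _ X](divn_eq m N.+1) count_belowD.
apply: (leq_trans _ (leq_addr _ _)); elim: (m %/ _) => // q IH.
rewrite mulSn addnC count_belowD -addn1 leq_add//.
have [n nN An] := synA (q * N.+1).
exact: (@count_below_gt0 _ n).
Qed.

(** * The rank-one word *)

(** [block k] is the indicator of the 1s of B_k, extended by zeros, and
    [height k] is the length of B_k. *)
Fixpoint height k := if k is j.+1 then 2 * height j + 2 * j else 2.

Fixpoint block k n : bool :=
  if k is j.+1 then block j n || (height j <= n) && block j (n - height j)
  else n == 0.

Definition limit_word n := block n n.

(** The total length of the spacers is controlled because the series of
    2k / 2^k converges; this is the closed form of that bound. *)
Lemma height_expn k : height k + 2 * k + 2 = 4 * 2 ^ k.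
Proof. by elim: k => //= k IH; rewrite expnS; lia. Qed.

Lemma ltn_height k : k < height k.
Proof. by elim: k => //= k IH; lia. Qed.

Lemma leq_height : {homo height : j k / j <= k}.
Proof. by apply: homo_leq => [//|? ? ?|k /=]; [exact: leq_trans|lia]. Qed.

Lemma block_lt k n : block k n -> n < height k.
Proof.
elim: k n => [|k IH] n /=; first by move/eqP ->.
by case/orP=> [/IH|/andP[? /IH]]; lia.
Qed.

Lemma block_stable j k n : j <= k -> n < height j -> block k n = block j n.
Proof.
move=> + nj; elim: k => [|k IH]; first by rewrite leqn0 => /eqP ->.
rewrite leq_eqVlt ltnS => /orP[/eqP -> //|jk] /=.
by rewrite IH// leqNgt (leq_trans nj (leq_height jk)) orbF.
Qed.

Lemma limit_wordE k n : n < height k -> limit_word n = block k n.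
Proof.
move=> nk; rewrite /limit_word; case: (leqP k n) => kn.
  exact: block_stable.
by rewrite -(block_stable (ltnW kn))// ltn_height.
Qed.

(** In B_(k+1) = B_k B_k 0^(2k), this is the second copy of B_k, and the next
    lemma is the spacer. *)
Lemma limit_word_second k i : i < height k ->
  limit_word (height k + i) = limit_word i.
Proof.
move=> ik; rewrite (@limit_wordE k.+1) /=; last by lia.
rewrite leq_addr/= addKn (limit_wordE ik); case: (boolP (block k (_ + i))) => //.
by move/block_lt; lia.
Qed.

Lemma limit_word_spacer k i : i < 2 * k ->
  limit_word (2 * height k + i) = false.
Proof.
move=> ik; rewrite (@limit_wordE k.+1) /=; last by lia.
by apply/negP => /orP[/block_lt|/andP[_ /block_lt]]; lia.
Qed.

(** All heights are even, so copies of B_0 = 10 only start at even positions. *)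
Lemma odd_limit_word n : limit_word n -> ~~ odd n.
Proof.
have oddh k : ~~ odd (height k) by case: k => //= j; rewrite oddD !oddM.
rewrite /limit_word; move: {1}n => k.
elim: k n => [|k IH] n /=; first by move/eqP ->.
case/orP=> [/IH//|/andP[hn /IH]].
by rewrite oddB// (negbTE (oddh k)) addbF.
Qed.

Definition agree n (y z : nat -> bool) := forall i, i < n -> y i = z i.
Definition shiftn n (y : nat -> bool) i := y (n + i).

Lemma agree_sym n y z : agree n y z -> agree n z y.
Proof. by move=> yz i /yz. Qed.

Lemma agree_trans n y x z : agree n x y -> agree n y z -> agree n x z.
Proof. by move=> xy yz i ni; rewrite xy// yz. Qed.

(** Beyond the level k = s + 1, the word w is a concatenation of copies of B_k,
    each ending with the spacer of length 2s >= s, and of zeros.  A window of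
    length 3 |B_k| therefore contains such a spacer or a run of s further zeros. *)
Lemma limit_word_zeros s : exists N, forall m, exists2 n,
  n <= N & agree s (shiftn (m + n) limit_word) (fun=> false).
Proof.
pose k := s.+1; exists (2 * height k).
(* Inside B_j the run has to end before the end of B_j, which is what lets
   the induction on j pass to the concatenation B_j B_j 0^(2j). *)
suff H j : k <= j -> forall m, m + height k <= height j ->
    exists n, [/\ m <= n <= m + 2 * height k, n + s <= height j &
      forall i, i < s -> limit_word (n + i) = false].
  move=> m; have kh : k <= m + height k by have := ltn_height k; lia.
  have [n [mn _ nz]] := H _ kh m (ltnW (ltn_height _)).
  exists (n - m); first lia.
  by move=> i /nz; rewrite /shiftn subnKC//; lia.
elim: j => [|j IH]; first by rewrite leqn0.
rewrite leq_eqVlt => /orP[/eqP <- {j IH} m mh|]; last rewrite ltnS => kj m mh.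
  exists (2 * height s + s); split; rewrite /k/= in mh *; try lia.
  by move=> i si; rewrite -addnA limit_word_spacer//; lia.
have hj := leq_height kj; have sk : 2 * height s + 2 * s = height k by [].
have sj := ltn_height j.
(* The window starts well inside the first B_j; near its end, and the run is
   the spacer ending the first B_k of the second B_j; well inside the second
   B_j; or near its end, and the run lies in the spacer 0^(2j). *)
have [c1|c1] := leqP (m + height k) (height j).
  by have [n [mn nj nz]] := IH kj m c1; exists n; split => //=; lia.
have [c2|c2] := leqP m (height j).
  exists (height j + (2 * height s + s)); rewrite /=; split; try lia.
  move=> i si; rewrite -addnA limit_word_second; last lia.
  by rewrite -addnA limit_word_spacer//; lia.
have [c3|c3] := leqP (m + height k) (2 * height j).
  have [|n [mn nj nz]] := IH kj (m - height j); first lia.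
  exists (height j + n) => /=; split; try lia.
  by move=> i si; rewrite -addnA limit_word_second ?nz//; lia.
rewrite /= in mh.
exists (maxn m (2 * height j)) => /=; split; try lia.
move=> i si; set q := maxn _ _ + i.
have -> : q = 2 * height j + (q - 2 * height j) by rewrite /q; lia.
by rewrite limit_word_spacer//; lia.
Qed.

(** B_j contains 2^(j-K) disjoint copies of B_K. *)
Lemma count_limit_word K j : K <= j ->
  2 ^ (j - K) <= count_below
    [set n | agree (height K) (shiftn n limit_word) limit_word] (height j).
Proof.
(* Only the occurrences lying inside B_j are counted, so that they repeat in
   the second copy of B_j. *)
move=> Kj; pose A j := [set n | n + height K <= height j /\
  agree (height K) (shiftn n limit_word) limit_word].
suff H : 2 ^ (j - K) <= count_below (A j) (height j).
  by apply: (leq_trans H); apply: count_below_subset => n [].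
have base : 0 < count_below (A K) (height K).
  case: (height K) (ltn_height K) => // h _.
  rewrite -(add1n h) count_belowD count_belowS mem_set; first by rewrite addn1.
  by split.
elim: j Kj => [|j IH]; first by rewrite leqn0 => /eqP <-; rewrite subnn.
rewrite leq_eqVlt => /orP[/eqP <-|]; first by rewrite subnn.
rewrite ltnS => Kj; rewrite subSn// expnS mul2n -addnn.
have -> : height j.+1 = height j + (height j + 2 * j) by rewrite /=; lia.
rewrite !count_belowD addnA (leq_trans _ (leq_addr _ _))// leq_add//;
  apply: (leq_trans (IH Kj)); apply: count_below_subset => n [nj nK].
  by split => //=; lia.
split => /=; first lia.
by move=> i iK; rewrite /shiftn -addnA limit_word_second; [exact: nK|lia].
Qed.

Lemma limit_word_recurrent L M :
  exists2 n, (M <= n) & agree L (shiftn n limit_word) limit_word.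
Proof.
exists (height (L + M)).
  exact: leq_trans (leq_addl L M) (ltnW (ltn_height _)).
move=> i iL; apply: limit_word_second.
by rewrite (leq_trans iL)// (leq_trans (leq_addr M L))// ltnW// ltn_height.
Qed.

(** * Borel probabilities from contents on clopen sets *)

Local Open Scope ring_scope.

Lemma ultra_fmap (T U : Type) (f : T -> U) (F : set_system T) :
  UltraFilter F -> UltraFilter (f @ F).
Proof.
move=> FU; split; first exact: fmap_proper_filter.
move=> G GP FG; apply/seteqP; split => // B GB.
have [//|FnB] := in_ultra_setVsetC (f @^-1` B) FU.
have /FG GnB : (f @ F) (~` B) by [].
by have := @filter_not_empty _ _ GP; rewrite -(setICr B); case; exact: filterI.
Qed.

(** A copy of the space whose measurable sets are the clopen ones, so that
    Caratheodory's extension applies to contents on clopen sets. *)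
Definition clopen_algebra (X : Type) := X.

Section ClopenAlgebra.
Variables (R : realType) (X : pointedMetricType R).

Fact clopen_display : measure_display. Proof. exact: default_measure_display. Qed.

HB.instance Definition _ := Pointed.on (clopen_algebra X).
HB.instance Definition _ :=
  @isAlgebraOfSets.Build clopen_display (clopen_algebra X)
  (@clopen X) (@clopen0 X) (@clopenU X) (fun B => @clopenC X B B).

Hypotheses (cX : compact [set: X]) (zX : zero_dimensional X).

Lemma clopen_nbhs (x : X) (U : set X) : open U -> U x ->
  exists C, [/\ clopen C, C x & C `<=` U].
Proof.
move=> oU Ux; have hX : hausdorff_space X by exact: metric_hausdorff.
have [|C [Cx cC] CU] := zero_dimensional_cvg hX zX cX (_ : nbhs x U).
  exact: open_nbhs_nbhs.
by exists C.
Qed.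

(** A compact metric space has countably many clopen sets, and in dimension zero
    every open set is the union of the clopen sets that it contains. *)
Lemma sigma_open_clopen : <<s @open X >> = <<s @clopen X >>.
Proof.
apply/seteqP; split; last first.
  by apply: sub_smallest2r; [exact: smallest_sigma_algebra|move=> A []].
apply: smallest_sub; first exact: smallest_sigma_algebra.
move=> U oU; have E := unsquash (clopen_surj cX).
have -> : U = \bigcup_n (if pselect (E n `<=` U) then E n else set0).
  apply/seteqP; split=> [x Ux|x [n _]]; last by case: pselect => // EU /EU.
  have [C [cC Cx CU]] := clopen_nbhs oU Ux.
  have [n _ En] := @surj _ _ _ _ E C cC.
  by exists n => //; case: pselect; rewrite En.
apply: sigma_algebra_bigcup => n; case: pselect => EU /=.
  by apply: sub_sigma_algebra; exact: funS.
exact: sigma_algebra0.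
Qed.

Section Extension.
Variable m : set X -> R.
Hypotheses (m_ge0 : forall A, 0 <= m A) (mT : m setT = 1).
Hypothesis mU : forall A B, clopen A -> clopen B ->
  A `&` B = set0 -> m (A `|` B) = m A + m B.

Let content (A : set (clopen_algebra X)) : \bar R := (m A)%:E.

Let content_ge0 A : (0 <= content A)%E. Proof. by rewrite lee_fin. Qed.

Let content_additive : measure_function.semi_additive content.
Proof.
apply/additive2P; last by move=> A B cA cB AB; rewrite /content mU.
have := mU (@clopen0 X) (@clopen0 X) (setI0 _).
by rewrite setU0 /content => /eqP; rewrite -subr_eq0 opprD addNKr oppr_eq0 => /eqP ->.
Qed.

HB.instance Definition _ := isContent.Build clopen_display (clopen_algebra X) R
  content content_ge0 content_additive.

(** A countable clopen cover of a clopen set has a finite subcover, so that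
    countable subadditivity reduces to finite subadditivity. *)
Let content_sigma_subadditive : measurable_subset_sigma_subadditive content.
Proof.
move=> A F mF mA AF; have cA : compact (A : set X).
  by apply: (subclosed_compact _ cX); [exact: mA.2|].
move: cA; rewrite compact_cover => /(_ nat setT F) [||D _ AD].
- by move=> i _; exact: (mF i).1.
- exact: AF.
apply: (@le_trans _ _ (\sum_(i \in [set` D]) content (F i))%E).
  exact: content_sub_fsum.
rewrite nneseries_esum// fsbig_finite//=.
rewrite esum_ge//; exists [set` D] => //.
by rewrite fsbig_finite.
Qed.

HB.instance Definition _ := Content_SigmaSubAdditive_isMeasure.Build
  clopen_display R (clopen_algebra X) content content_sigma_subadditive.

Let mu (A : set (borel_space X)) : \bar R := measure_extension content A.

Let mu0 : mu set0 = 0%E. Proof. exact: measure0. Qed.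
Let mu_ge0 A : (0 <= mu A)%E. Proof. exact: measure_ge0. Qed.
Let mu_sigma_additive : semi_sigma_additive mu.
Proof.
move=> F mF tF mUF.
have H (A : set X) : <<s @open X >> A -> <<s @clopen X >> A.
  by rewrite sigma_open_clopen.
apply: (@measure_semi_sigma_additive _ _ _ (measure_extension content)) => //.
  by move=> i; apply: H; exact: mF.
by apply: H; exact: mUF.
Qed.

HB.instance Definition _ := isMeasure.Build _ (borel_space X) R mu
  mu0 mu_ge0 mu_sigma_additive.

Let muE A : clopen A -> mu A = (m A)%:E.
Proof. by move=> cA; rewrite /mu /measure_extension measurable_mu_extE. Qed.

Let mu_setT : mu setT = 1%E.
Proof. by rewrite muE ?mT//; exact: clopenT. Qed.

HB.instance Definition _ := Measure_isProbability.Build _ (borel_space X) R mu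
  mu_setT.

(** Compactness of the clopen sets turns finite additivity into countable
    additivity, so the extension theorem for premeasures applies. *)
Lemma clopen_extension : exists P : probability (borel_space X) R,
  forall A, clopen A -> P A = (m A)%:E.
Proof. by exists mu; exact: muE. Qed.

End Extension.
End ClopenAlgebra.

(** * Invariant measures from visit frequencies *)

Section InvariantMeasures.
Variables (R : realType) (X : pointedMetricType R).
Hypotheses (cX : compact [set: X]) (zX : zero_dimensional X).
Variable f : X -> X.
Hypothesis cf : continuous f.

(** Clopen sets are stable under intersection and generate the Borel sets, so
    the measure and its image agree everywhere once they agree on them. *)
Lemma invariant_on_clopen (mu : probability (borel_space X) R) :
  (forall A, clopen A -> mu (f @^-1` A) = mu A) -> invariant_measure f mu.
Proof.
move=> muf A mA.
have mf : measurable_fun setT (f : borel_space X -> borel_space X).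
  apply: (@measurability _ _ (borel_space X) (borel_space X) setT f (@open X)).
    by [].
  move=> _ [U oU <-].
  rewrite setTI; suff: open (f @^-1` U) by exact: (@sub_sigma_algebra _ setT (@open X)).
  by apply: open_comp => // x _; exact: cf.
pose nu := [the measure _ _ of pushforward mu (f : borel_space X -> borel_space X)].
apply: (@measure_unique _ R (borel_space X) (@clopen X) (fun=> setT) _ _ _ _
  (nu mf) mu) => //=.
- exact: sigma_open_clopen.
- by move=> B C; exact: clopenI.
- by move=> _; exact: clopenT.
- by apply/seteqP; split=> // x _; exists 0%N.
- by move=> _; rewrite /pushforward preimage_setT probability_setT ltry.
Qed.

Definition visit_frequency (p : X) (N : nat -> nat) (A : set X) (j : nat) : R :=
  (count_below [set i | A (iter i f p)] (N j))%:R / (N j)%:R.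

Lemma visit_frequency_ge0 p N A j : 0 <= visit_frequency p N A j.
Proof. by rewrite /visit_frequency divr_ge0. Qed.

Lemma visit_frequency_le1 p N A j : visit_frequency p N A j <= 1.
Proof.
rewrite /visit_frequency; case: (N j) => [|n]; first by rewrite invr0 mulr0.
by rewrite ler_pdivrMr ?ltr0n// mul1r ler_nat (leq_trans (max_card _))// card_ord.
Qed.

Lemma visit_frequencyU p N A B j : A `&` B = set0 ->
  visit_frequency p N (A `|` B) j =
  visit_frequency p N A j + visit_frequency p N B j.
Proof.
move=> AB; rewrite /visit_frequency -mulrDl -natrD; congr (_%:R / _).
elim: (N j) => [|n IH]; first by rewrite !count_below0.
rewrite !count_belowS IH addnACA; congr addn.
have -> : (n \in [set i | (A `|` B) (iter i f p)]) =
    (n \in [set i | A (iter i f p)]) || (n \in [set i | B (iter i f p)]).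
  by rewrite -in_setU.
case: (boolP (n \in [set i | A _])) => // /set_mem /= An.
case: (boolP (n \in [set i | B _])) => // /set_mem /= Bn.
by have : set0 (iter n f p) by rewrite -AB.
Qed.

(** Visits to the preimage are visits to the set shifted by one time unit, so
    the two counts differ by at most one. *)
Lemma visit_frequency_preimage p N A j :
  `|visit_frequency p N (f @^-1` A) j - visit_frequency p N A j| <= (N j)%:R^-1.
Proof.
rewrite /visit_frequency -mulrBl normrM [X in _ * X]ger0_norm// ler_piMl//.
set a := count_below _ _; set b := count_below _ _.
have -> : a = count_below [set i | A (iter (1 + i) f p)] (N j) by [].
have := count_belowD [set i | A (iter i f p)] 1 (N j).
rewrite (count_belowS _ 0) count_below0 add0n add1n count_belowS -/a -/b.
rewrite ler_norml => /(congr1 (fun n : nat => n%:R : R)); rewrite !natrD => H.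
have := H; case: (_ \in _) => {H}; case: (_ \in _) => /= H; lra.
Qed.

(** An ultrafilter on the times provides limits of all visit frequencies at
    once.  The limits are additive, hence extend from clopen sets to a measure,
    and this measure is invariant as the frequencies of a set and of its
    preimage have the same limit.  Lower bounds on the frequencies persist, which
    is how the support is controlled. *)
Theorem Krylov_Bogoliubov p (N : nat -> nat) : N @ \oo --> \oo ->
  exists2 mu : probability (borel_space X) R, invariant_measure f mu &
    forall A c, clopen A ->
      (\forall j \near \oo, c <= visit_frequency p N A j) -> (c%:E <= mu A)%E.
Proof.
move=> Noo; have [G [GU ooG]] := ultraFilterLemma (eventually_filter).
have NG M : \forall j \near G, (M <= N j)%N by apply: ooG; exact: Noo (nbhs_infty_ge M).
have GP : ProperFilter G := @ultra_proper _ _ GU.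
pose m A : R := lim (visit_frequency p N A @ G).
have m_cvg A : visit_frequency p N A @ G --> m A.
  have := @segment_compact R 0 1; rewrite compact_ultra.
  move=> /(_ _ (@ultra_fmap _ _ (visit_frequency p N A) G GU)) [|l [_ /= lP]].
    apply: (@filterE _ G) => j /=.
    by rewrite in_itv /= visit_frequency_ge0 visit_frequency_le1.
  by apply/cvg_ex; exists l.
have m_ge0 A : 0 <= m A.
  apply: limr_ge; first exact/cvg_ex/(ex_intro _ (m A)).
  by apply: filterE => j; exact: visit_frequency_ge0.
have mU A B : A `&` B = set0 -> m (A `|` B) = m A + m B.
  move=> AB; apply: cvg_lim => //.
  rewrite (_ : visit_frequency p N (A `|` B) =
    visit_frequency p N A \+ visit_frequency p N B); first exact: cvgD.
  by apply/funext => j; exact: visit_frequencyU.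
have mT : m setT = 1.
  apply: cvg_lim => //; apply: cvg_near_cst.
  apply: filterS (NG 1%N) => j Nj; rewrite /visit_frequency.
  rewrite (_ : count_below _ _ = N j) ?divff// ?pnatr_eq0 -?lt0n//.
  elim: (N j) => [|n IH]; first by rewrite count_below0.
  by rewrite count_belowS IH mem_set// addn1.
have [mu muE] := clopen_extension cX zX m_ge0 mT (fun A B _ _ => @mU A B).
exists mu => [|A c cA cj].
  apply: invariant_on_clopen => A cA.
  rewrite !muE//; last exact: preimage_clopen.
  congr EFin; apply/eqP; rewrite -subr_eq0 -normr_le0; apply/ler_addgt0Pr => e e0.
  rewrite add0r.
  have mB : (visit_frequency p N (f @^-1` A) - visit_frequency p N A) @ G -->
     m (f @^-1` A) - m A by exact: cvgB.
  move/cvg_norm : mB => /cvgr_to_le; apply.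
  have [M _ Me] := near_infty_natSinv_lt (PosNum e0).
  apply: filterS (NG M.+1) => j Nj.
  apply: (le_trans (visit_frequency_preimage _ _ _ _)).
  apply: (le_trans _ (ltW (Me M _))) => //=.
  by rewrite lef_pV2 ?posrE ?ltr0n ?ler_nat//; exact: leq_trans Nj.
rewrite muE// lee_fin; apply: limr_ge; first exact/cvg_ex/(ex_intro _ (m A)).
exact: ooG.
Qed.

End InvariantMeasures.

(** * Shadowing by a syndetically approached fixed point *)

Section LowerDensity.
Variable R : realType.

Lemma lower_density_ge (A : set nat) (c : R) :
  (\forall n \near \oo, c <= (count_below A n.+1)%:R / n.+1%:R) ->
  c <= lower_density R A.
Proof.
pose u n : R := (count_below A n.+1)%:R / n.+1%:R.
move=> [M _ Mc]; rewrite /lower_density -/u.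
have u01 n : 0 <= u n <= 1.
  rewrite /u divr_ge0//= ler_pdivrMr ?ltr0n// mul1r ler_nat.
  by rewrite (leq_trans (max_card _))// card_ord.
have bu : bounded_fun u.
  exists 1; split; first exact: num_real.
  move=> r r1 n _ /=; have /andP[u0 u1] := u01 n.
  by rewrite ger0_norm// (le_trans u1)// ltW.
rewrite limn_infE//; apply: (@le_trans _ _ (infs u M)).
  apply: lb_le_inf; first by exists (u M), M => /=.
  by move=> _ [n /= Mn <-]; exact: Mc.
apply: ub_le_sup; last by exists M.
exact: bounded_fun_has_ubound_infs.
Qed.

End LowerDensity.

Section SyndeticShadowing.
Variables (R : realType) (X : pointedMetricType R) (f : X -> X).
Hypothesis ucf : forall eps : R, 0 < eps -> exists2 delta : R, 0 < delta &
  forall y z, mdist y z < delta -> mdist (f y) (f z) < eps.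

(** Over a bounded time, the errors of a pseudo-orbit cannot build up. *)
Lemma pseudo_orbit_tracing N (eps : R) : 0 < eps -> exists2 delta : R, 0 < delta &
  forall x : nat -> X,
    (forall i, (i < N)%N -> mdist (f (x i)) (x i.+1) < delta) ->
    forall n, (n <= N)%N -> mdist (iter n f (x 0%N)) (x n) < eps.
Proof.
elim: N eps => [|N IH] eps e0.
  exists 1 => // x _ n; rewrite leqn0 => /eqP -> /=.
  by rewrite mdistxx.
have e20 : 0 < eps / 2 by rewrite divr_gt0.
have [d1 d10 H1] := ucf e20.
have [|d2 d20 H2] := IH (Num.min d1 eps); first by rewrite lt_min d10.
exists (Num.min d2 (eps / 2)); first by rewrite lt_min d20.
move=> x xd n nN.
have {}H2 k : (k <= N)%N -> mdist (iter k f (x 0%N)) (x k) < Num.min d1 eps.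
  by apply: H2 => i iN; have := xd i (ltnW iN); rewrite lt_min => /andP[].
move: nN; rewrite leq_eqVlt ltnS => /orP[/eqP ->|/H2]; last first.
  by rewrite lt_min => /andP[].
have := H2 N (leqnn N); rewrite lt_min => /andP[/H1 HN _].
have := xd N (leqnn _); rewrite lt_min => /andP[_ xN].
rewrite [eps]splitr; apply: (le_lt_trans (metric_triangle _ (f (x N)) _)).
exact: ltrD.
Qed.

(** In every window of length [N.+1], either the pseudo-orbit makes an error,
    or it follows a true orbit closely enough to come near the fixed point.
    Errors have zero density, so the second case has lower density at least
    1 / (N + 1); the bound 1 / (2 (N + 1)) used below leaves room for the
    limits. *)
Theorem M0_shadowing_of_syndetic_fixpoint p : f p = p ->
  (forall eps : R, 0 < eps -> exists N, forall y, exists2 n, (n <= N)%N &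
    mdist p (iter n f y) < eps) ->
  M0_shadowing f.
Proof.
move=> fp syn eps e0; have e20 : 0 < eps / 2 by rewrite divr_gt0.
have [N synN] := syn _ e20.
have [d d0 trace] := pseudo_orbit_tracing N e20.
exists d => // x px; exists p.
set A := [set j | _]; set E := [set i | d <= mdist (f (x i)) (x i.+1)] in px *.
have synAE i : exists2 n, (n <= N)%N & (A `|` E) (i + n)%N.
  have [[k kN Ek]|noE] := pselect (exists2 k, (k < N)%N & E (i + k)%N).
    by exists k; [exact: ltnW|right].
  have [n nN pn] := synN (x i); exists n => //; left; rewrite /A /=.
  have -> : iter (i + n) f p = p by elim: (i + n)%N => //= k ->.
  rewrite [eps]splitr; apply: (le_lt_trans (metric_triangle _ (iter n f (x i)) _)).
  apply: ltrD => //; have := trace (fun k => x (i + k)%N) _ n nN.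
  rewrite addn0; apply => k kN; rewrite addnS ltNge; apply/negP => dk.
  by apply: noE; exists k.
pose c : R := N.+1%:R^-1; have c0 : 0 < c by rewrite invr_gt0 ltr0n.
have c40 : 0 < c / 4 by rewrite divr_gt0.
apply: (@lt_le_trans _ _ (c / 2)); first by rewrite divr_gt0.
apply: lower_density_ge.
have [M1 _ HM1] := near_infty_natSinv_lt (PosNum c40).
move/cvgrPdist_lt : px => /(_ _ c40)[M2 _ HM2].
exists (maxn M1 M2) => // n /=; rewrite geq_max => /andP[M1n M2n].
have := HM1 n M1n; have := HM2 n.+1 (leqW M2n).
rewrite /= sub0r normrN ger0_norm ?mulr_ge0 ?invr_ge0// mulrC => HE Hn.
have := leq_trans (count_below_syndetic n.+1 synAE) (count_below_setU A E n.+1).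
rewrite -(ler_nat R) natrD => Hc.
have Hd : (n.+1%:R : R) <= ((n.+1 %/ N.+1)%N%:R + 1) * N.+1%:R.
  rewrite natr1 -natrM ler_nat.
  by have := divn_eq n.+1 N.+1; have := ltn_pmod n.+1 (ltn0Sn N); lia.
have n0 : 0 < n.+1%:R :> R by rewrite ltr0n.
rewrite ler_pdivlMr//.
move: HE; rewrite ltr_pdivrMr// => HE.
move: Hn; rewrite -div1r ltr_pdivrMr// => Hn.
have {}Hd : n.+1%:R * c <= (n.+1 %/ N.+1)%N%:R + 1 by rewrite ler_pdivrMr ?ltr0n.
lra.
Qed.

End SyndeticShadowing.

(** * Orbit closures of binary words *)

Section Baire.
Variable R : realType.
Implicit Types x y z : nat -> bool.

(** The distance is 1 / (n + 1) where [n] is the first position at which the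
    sequences differ. *)
Definition baire_dist y z : R :=
  if pselect (exists n, y n != z n) is left e then (ex_minn e).+1%:R^-1 else 0.

Lemma baire_dist_le y z L : baire_dist y z <= L.+1%:R^-1 <-> agree L y z.
Proof.
rewrite /baire_dist; case: pselect => [e|yz].
  case: ex_minnP => m ym min; rewrite lef_pV2 ?posrE ?ltr0n// ler_nat ltnS.
  split=> [Lm i iL|yzL]; last first.
    by rewrite leqNgt; apply/negP => /yzL /eqP; apply/negP.
  apply/eqP/negPn/negP => /min; lia.
split=> [_ i _|_]; last by rewrite invr_ge0.
by apply/eqP/negPn/negP => yi; apply: yz; exists i.
Qed.

Lemma baire_dist_cases y z :
  (baire_dist y z = 0 /\ y = z) \/ exists L, baire_dist y z = L.+1%:R^-1.
Proof.
rewrite /baire_dist; case: pselect => [e|yz]; first by right; eexists.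
left; split=> //; apply/funext => i.
by apply/eqP/negPn/negP => yi; apply: yz; exists i.
Qed.

Lemma baire_distxx y : baire_dist y y = 0.
Proof. by rewrite /baire_dist; case: pselect => // e; exfalso; case: e => n /eqP. Qed.

Lemma baire_dist_ge0 y z : 0 <= baire_dist y z.
Proof. by rewrite /baire_dist; case: pselect. Qed.

Lemma baire_dist_eq0 y z : baire_dist y z = 0 -> y = z.
Proof.
by case: (baire_dist_cases y z) => [[]//|[L ->]] /eqP; rewrite invr_eq0 pnatr_eq0.
Qed.

Lemma le_baire_dist x x' y y' : (forall L, agree L x x' -> agree L y y') ->
  baire_dist y y' <= baire_dist x x'.
Proof.
have [[-> <-]|[L xL]] := baire_dist_cases x x'; last first.
  by rewrite xL => /(_ L) yL; apply/baire_dist_le/yL/baire_dist_le; rewrite xL.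
move=> yy; suff -> : y = y' by rewrite baire_distxx.
by apply/funext => i; exact: (yy i.+1).
Qed.

Lemma baire_dist_sym y z : baire_dist y z = baire_dist z y.
Proof.
by apply/eqP; rewrite eq_le; apply/andP; split; apply: le_baire_dist => L; exact: agree_sym.
Qed.

Lemma baire_dist_triangle y x z :
  baire_dist x z <= baire_dist x y + baire_dist y z.
Proof.
have [xy|/ltW yz] := leP (baire_dist x y) (baire_dist y z).
- apply: (@le_trans _ _ (baire_dist y z)); last by rewrite lerDr baire_dist_ge0.
  apply: le_baire_dist => L yzL; apply: (agree_trans _ yzL).
  by apply/baire_dist_le; rewrite (le_trans xy)//; exact/baire_dist_le.
- apply: (@le_trans _ _ (baire_dist x y)); last by rewrite lerDl baire_dist_ge0.
  apply: le_baire_dist => L xyL; apply: (agree_trans xyL).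
  by apply/baire_dist_le; rewrite (le_trans yz)//; exact/baire_dist_le.
Qed.

End Baire.

(** The closure of the shift orbit of [w] in the space of binary sequences.  The
    field [R] of values of the distance is a parameter so that the metric
    structure can be attached to the type. *)
Record word_hull (R : realType) (w : nat -> bool) := WordHull {
  hull_val :> nat -> bool;
  hull_valP : forall L, exists n, agree L hull_val (shiftn n w) }.

HB.instance Definition _ R w := gen_eqMixin (word_hull R w).
HB.instance Definition _ R w := gen_choiceMixin (word_hull R w).

Section WordHull.
Variables (R : realType) (w : nat -> bool).
Local Notation X := (word_hull R w).

Lemma hull_val_inj : injective (@hull_val R w).
Proof.
move=> [y hy] [z hz] /= yz; case: z / yz hz => hz.
by rewrite (Prop_irrelevance hy hz).
Qed.

Fact word_in_hull L : exists n, agree L w (shiftn n w).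
Proof. by exists 0%N. Qed.

Definition hull_word : X := @WordHull R w w word_in_hull.

HB.instance Definition _ := isPointed.Build X hull_word.

HB.instance Definition _ := @isMetric.Build R X
  (fun y z => baire_dist R y z)
  (fun y => baire_distxx R y)
  (fun y z yz => hull_val_inj (baire_dist_eq0 yz))
  (fun y z => baire_dist_sym R y z)
  (fun y x z => baire_dist_triangle R y x z).

End WordHull.

Section HullTopology.
Variables (R : realType) (w : nat -> bool).
Local Notation X := (word_hull R w).
Implicit Types y z : X.

Lemma hull_dist_le y z L : mdist y z <= L.+1%:R^-1 :> R <-> agree L y z.
Proof. exact: baire_dist_le. Qed.

Lemma small_radius (eps : R) : 0 < eps -> exists L, L.+1%:R^-1 < eps.
Proof.
by move=> e0; have [L _ HL] := near_infty_natSinv_lt (PosNum e0);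
  exists L; exact: (HL L (leqnn L)).
Qed.

Lemma hull_openP (U : set X) :
  open U <-> forall y, U y -> exists L, forall z, agree L y z -> U z.
Proof.
split=> [oU y Uy|H].
  have /nbhs_ballP[e /= e0 eU] : nbhs y U by exact: open_nbhs_nbhs.
  have [L Le] := small_radius e0; exists L => z /hull_dist_le yz.
  by apply: eU; rewrite ballEmdist /=; exact: le_lt_trans Le.
rewrite openE => y /H[L LU]; apply/nbhs_ballP; exists L.+1%:R^-1 => /=.
  by rewrite invr_gt0.
by rewrite ballEmdist => z /= /ltW/hull_dist_le/LU.
Qed.

Definition cylinder (u : nat -> bool) L : set X := [set z : X | agree L u z].

Lemma clopen_cylinder u L : clopen (cylinder u L).
Proof.
split; first by apply/hull_openP => y uy; exists L => z; exact: agree_trans.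
rewrite -[cylinder u L]setCK; apply: open_closedC; apply/hull_openP => y uy.
exists L => z yz uz.
by apply: uy; apply: (agree_trans uz); exact: agree_sym.
Qed.

Lemma hull_zero_dimensional : zero_dimensional X.
Proof.
move=> y z /eqP yz; have [L yzL] : exists L, ~ agree L y z.
  apply/existsNP => yz'; apply: yz; apply: hull_val_inj.
  by apply/funext => i; exact: (yz' i.+1).
by exists (cylinder y L); split => //; exact: clopen_cylinder.
Qed.

(** The limit of an ultrafilter is read off coordinatewise. *)
Lemma hull_compact : compact [set: X].
Proof.
rewrite compact_ultra => F FU _; have FP : ProperFilter F := @ultra_proper _ _ FU.
pose u i := `[< F [set z : X | z i] >].
have Fu L : F (cylinder u L).
  elim: L => [|L IH]; first by apply: filterE => z i.
  have FuL : F [set z : X | u L = z L].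
    have [Ft|Ff] := in_ultra_setVsetC [set z : X | z L] FU.
      have uL : u L by apply/asboolP.
      by apply: filterS Ft => z /= ->.
    suff -> : u L = false by apply: filterS Ff => z /= /negP/negbTE ->.
    apply/asboolPn => Ft; apply: (@filter_not_empty _ F).
    by rewrite -(setICr [set z : X | z L]); exact: filterI.
  apply: filterS (filterI IH FuL) => z [uz uzL] i.
  by rewrite ltnS leq_eqVlt => /orP[/eqP ->|/uz].
have hu L : exists n, agree L u (shiftn n w).
  have [z uz] := filter_ex (Fu L); have [n zn] := hull_valP z L.
  by exists n; exact: agree_trans zn.
exists (WordHull R hu); split => // U.
rewrite nbhsE => -[V [oV Vu] VU]; have /hull_openP/(_ _ Vu)[L LV] := oV.
by apply: filterS (Fu L) => z uz; apply/VU/LV.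
Qed.

Fact shift_in_hull y L : exists n, agree L (shiftn 1 y) (shiftn n w).
Proof.
have [n yn] := hull_valP y L.+1; exists n.+1 => i iL.
by rewrite [LHS]yn// /shiftn addnA addn1.
Qed.

Definition hull_shift y : X := WordHull R (shift_in_hull y).

Lemma iter_hull_shift n y : hull_val (iter n hull_shift y) = shiftn n y.
Proof.
elim: n => // n IH; rewrite iterS; apply/funext => i /=.
by rewrite IH /shiftn addnA addn1.
Qed.

Lemma hull_shift_unif_continuous (eps : R) : 0 < eps ->
  exists2 delta : R, 0 < delta &
  forall y z, mdist y z < delta -> mdist (hull_shift y) (hull_shift z) < eps.
Proof.
move=> /small_radius[L Le]; exists L.+2%:R^-1; first by rewrite invr_gt0.
move=> y z /ltW/hull_dist_le yz; apply: le_lt_trans Le; apply/hull_dist_le.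
by move=> i iL; exact: yz.
Qed.

Lemma hull_shift_continuous : continuous hull_shift.
Proof.
apply/continuousP => U /hull_openP oU; apply/hull_openP => y /oU[L LU].
by exists L.+1 => z yz; apply: LU => i iL; exact: yz.
Qed.

Hypothesis w_recurrent : forall L M,
  exists2 n, (M <= n)%N & agree L (shiftn n w) w.

Lemma hull_recurrent y L M : exists2 n, (M <= n)%N & agree L y (shiftn n w).
Proof.
have [n yn] := hull_valP y L; have [m mM wm] := w_recurrent (n + L) M.
exists (m + n)%N; first exact: leq_trans (leq_addr _ _).
by move=> i iL; rewrite yn// /shiftn -addnA [RHS]wm// ltn_add2l.
Qed.

(** Recurrence provides occurrences of the prefixes of [y] in [w] at positive
    positions, hence preceded by a letter; one of the two letters precedes
    prefixes of arbitrary length. *)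
Lemma hull_shift_surjective : range hull_shift = [set: X].
Proof.
apply/seteqP; split=> // y _.
pose prepend b i := if i is j.+1 then y j else b.
have [b hb] : exists b, forall L, exists n, agree L (prepend b) (shiftn n w).
  have [ht|/existsNP[L0 hL0]] :=
    pselect (forall L, exists n, agree L (prepend true) (shiftn n w)).
    by exists true.
  exists false => L; have [[//|n] _ yn] := hull_recurrent y (maxn L L0) 1.
  exists n => -[_ /=|i iL /=]; last first.
    by rewrite yn /shiftn ?addnS// leq_max (ltnW iL).
  apply/esym/negP => wn; apply: hL0; exists n => -[_ //=|i iL /=].
  by rewrite yn /shiftn ?addnS// leq_max (ltnW iL) orbT.
by exists (WordHull R hb) => //; apply: hull_val_inj; exact/funext.
Qed.

Lemma hull_shift_transitive : topologically_transitive hull_shift.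
Proof.
move=> U V /hull_openP oU /hull_openP oV [y Uy] [z Vz].
have [L LU] := oU y Uy; have [K KV] := oV z Vz.
have [a _ ya] := hull_recurrent y L 0.
have [b ab zb] := hull_recurrent z K a.+1.
exists (b - a)%N; split; first by rewrite subn_gt0.
exists (iter b hull_shift (hull_word R w)); split; last first.
  by apply: KV; rewrite iter_hull_shift.
exists (iter a hull_shift (hull_word R w)); last by rewrite -iterD subnK// ltnW.
by apply: LU; rewrite iter_hull_shift.
Qed.

End HullTopology.

(** * The rank-one shift *)

Lemma open_setX (T U : topologicalType) (A : set T) (B : set U) :
  open A -> open B -> open (A `*` B).
Proof.
move=> oA oB; rewrite openE => -[a b] [/= Aa Bb].
by exists (A, B) => //; split; apply: open_nbhs_nbhs.
Qed.

Section RankOneShift.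
Variable R : realType.
Local Notation X := (word_hull R limit_word).
Local Notation f := (@hull_shift R limit_word).

Lemma hull_parity (y : X) i j : y i -> y j -> odd i = odd j.
Proof.
have [n yn] := hull_valP y (maxn i j).+1.
rewrite !yn ?ltnS ?leq_maxl ?leq_maxr// => /odd_limit_word + /odd_limit_word.
by rewrite !oddD; case: (odd n); case: (odd i); case: (odd j).
Qed.

(** A common hitting time [n] would make both [n] and [n + 1] the distance
    between two 1s of one point. *)
Lemma hull_shift_not_weakly_mixing : ~ weakly_mixing f.
Proof.
pose C i : set X := [set y : X | y i].
have oC i : open (C i).
  by apply/hull_openP => y yi; exists i.+1 => z yz; rewrite /C /= -yz.
have C0 : C 0%N (hull_word R limit_word) by [].
have C1 : C 1%N (iter 1 f (hull_word R limit_word)) by [].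
move=> /(_ (C 0 `*` C 0)%N (C 0 `*` C 1)%N).
case=> [||||n [_ [_ [[[y z] [/= y0 z0] <-]]]]].
- exact: open_setX.
- exact: open_setX.
- by exists (hull_word R limit_word, hull_word R limit_word).
- by exists (hull_word R limit_word, iter 1 f (hull_word R limit_word)).
have -> : iter n (fun p : X * X => (f p.1, f p.2)) (y, z) = (iter n f y, iter n f z).
  by elim: n => //= n ->.
rewrite /C /= !iter_hull_shift /shiftn => -[yn zn].
by have := hull_parity y0 yn; have := hull_parity z0 zn; rewrite !oddD /=; case: (odd n).
Qed.

Fact zero_in_hull L : exists n, agree L (fun=> false) (shiftn n limit_word).
Proof.
have [N zN] := limit_word_zeros L; have [n _ nz] := zN 0%N.
by exists n; apply: agree_sym.
Qed.

Lemma hull_shift_M0_shadowing : M0_shadowing f.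
Proof.
apply: (@M0_shadowing_of_syndetic_fixpoint _ _ _ _ (WordHull R zero_in_hull)).
- exact: hull_shift_unif_continuous.
- exact: hull_val_inj.
move=> eps /small_radius[L Le]; have [N zN] := limit_word_zeros L; exists N => y.
have [m ym] := hull_valP y (N + L); have [n nN nz] := zN m.
exists n => //; apply: le_lt_trans Le; apply/hull_dist_le => i iL.
rewrite iter_hull_shift /shiftn ym; last by rewrite -addnS leq_add.
by rewrite /shiftn addnA; apply/esym/nz.
Qed.

(** An open set contains the cylinder of a subword of some B_K, and pulling this
    cylinder back by the shift gives a set visited whenever B_K occurs, that is
    with frequency at least 2^(j-K) / |B_j| >= 1 / (4 2^K) in B_j. *)
Lemma hull_full_support : exists mu : probability (borel_space X) R,
  invariant_measure f mu /\ measure_support mu = [set: X].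
Proof.
have hoo : height @ \oo --> \oo.
  apply/cvgnyPge => M; exists M => // j /= Mj.
  exact: leq_trans Mj (ltnW (ltn_height j)).
have cf := @hull_shift_continuous R limit_word.
have [mu muf mu_ge] := Krylov_Bogoliubov (@hull_compact R limit_word)
  (@hull_zero_dimensional R limit_word) cf (hull_word R limit_word) hoo.
exists mu; split=> //; apply/seteqP; split=> // y _ U oU Uy.
have [L LU] := (hull_openP U).1 oU y Uy; have [n yn] := hull_valP y L.
pose C : set X := cylinder y L; pose D := iter n f @^-1` C.
have cC : clopen C by exact: clopen_cylinder.
have [cD muD] : clopen D /\ mu D = mu C.
  rewrite /D; elim: (n) => // k [cD <-].
  have -> : iter k.+1 f @^-1` C = f @^-1` (iter k f @^-1` C).
    by apply/funext => x; rewrite /preimage /= -iterS iterSr.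
  split; first exact: preimage_clopen.
  by rewrite muf//; apply: sub_sigma_algebra; exact: cD.1.
apply: (@lt_le_trans _ _ (mu C)); last first.
  by apply: le_measure => //; rewrite inE; apply: sub_sigma_algebra => //; exact: cC.1.
rewrite -muD; pose K := (n + L)%N; pose c : R := (4 * 2 ^ K)%:R^-1.
apply: (@lt_le_trans _ _ c%:E).
  by rewrite lte_fin invr_gt0 ltr0n muln_gt0 expn_gt0.
apply: mu_ge => //; exists K => // j /= Kj.
rewrite /visit_frequency /c.
have cnt : (2 ^ (j - K) <=
    count_below [set i | D (iter i f (hull_word R limit_word))] (height j))%N.
  apply: (leq_trans (count_limit_word Kj)); apply: count_below_subset => i iK.
  rewrite /D /C /cylinder /= -iterD iter_hull_shift => k kL.
  rewrite yn// /shiftn /= [(n + i)%N]addnC -addnA [RHS]iK//.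
  by rewrite (leq_trans _ (ltnW (ltn_height _)))// ltn_add2l.
have hj : (height j <= 4 * 2 ^ j)%N by rewrite -height_expn -addnA leq_addr.
have h0 : (0 < height j)%N by exact: leq_ltn_trans (ltn_height j).
rewrite ler_pdivlMr ?ltr0n// mulrC ler_pdivrMr ?ltr0n ?muln_gt0 ?expn_gt0//.
rewrite -natrM ler_nat (leq_trans hj)// -{1}(subnK Kj) expnD.
by rewrite mulnCA leq_mul2r cnt orbT.
Qed.

End RankOneShift.

Theorem mainTheorem5 (R : realType) :
  exists (X : pointedMetricType R) (f : X -> X),
    [/\ E_system f, M0_shadowing f & ~ weakly_mixing f].
Proof.
exists (word_hull R limit_word), (@hull_shift R limit_word); split.
- split.
  + split; [exact: hull_compact|exact: hull_shift_continuous|].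
    exact: hull_shift_surjective limit_word_recurrent.
  + exact: hull_shift_transitive limit_word_recurrent.
  + exact: hull_full_support.
- exact: hull_shift_M0_shadowing.
- exact: hull_shift_not_weakly_mixing.
Qed.
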